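(* Let $k\ge 0$ be an integer and let $P(t),Q(t),R(t)\in\overline{\mathbb{Q}}[t]$ be polynomials satisfying $$tP^4(t)=(t-1)Q^4(t)+R^2(t),$$ with $\deg P(t)=\deg Q(t)=k$ and $\deg R(t)=2k$, and such that $t\cdot(t-1)\cdot P(t)\cdot Q(t)\cdot R(t)$ has no multiple roots. Then, up to replacing the polynomial $R(t)$ by $-R(t)$, the map $(u,v)\mapsto(x,y)$, where $$x=u\,\frac{P(t)}{Q(t)},\qquad y=v\,\frac{R(t)}{Q^2(t)},\qquad t=\frac{u^4}{v^2},$$ induces an endomorphism of $E$ (as an elliptic curve, i.e. a morphism $E\to E$ fixing the origin $O$) of degree $d=4k+1$.
   Context: $\overline{\mathbb{Q}}$ is the algebraic closure of $\mathbb{Q}$ in $\mathbb{C}$ and $i=\sqrt{-1}$. $E$ denotes the smooth projective curve of genus $1$ obtained as the normalization of the closure in $\mathbb{P}_2$ of the affine curve $v^2=u^4-1$ (with affine coordinates $(u,v)$); it is regarded as an elliptic curve with origin $O=(0,i)$. ''Up to replacing $R$ by $-R$'' means that the conclusion holds for at least one of the triples $(P,Q,R)$ and $(P,Q,-R)$. *)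

(* Defs.v *)
From HB Require Import structures.
From mathcomp Require Import all_boot all_order all_algebra all_field.
From mathcomp Require Import mpoly ring.

Set Implicit Arguments.
Unset Strict Implicit.
Unset Printing Implicit Defensive.

Import Order.TTheory GRing.Theory Num.Theory.
Local Open Scope ring_scope.

(* Projective n-space over \bar Q = algC is the set of lines of algC^(n+1).  *)
Definition proj (n : nat) : Type :=
  {L : {vspace 'rV[algC]_n.+1} | \dim L == 1%N}.

Definition rep n (p : proj n) : 'rV[algC]_n.+1 := vpick (val p).

(* x is a vector of homogeneous coordinates of p (hence x is nonzero). *)
Definition coords n (p : proj n) (x : 'rV[algC]_n.+1) : Prop :=
  val p = <[x]>%VS.

Definition mev m n (F : 'I_n.+1 -> {mpoly algC[m.+1]}) (x : 'rV[algC]_m.+1) :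
  'rV[algC]_n.+1 := \row_j (F j).@[x 0].

(* The smooth model of v^2 = u^4 - 1 : the intersection of the quadrics
   X0 X2 = X1^2 and X3^2 = X2^2 - X0^2 in P^3.  The affine point (u, v)
   corresponds to (1 : u : u^2 : v), and there are two points at infinity,
   (0 : 0 : 1 : 1) and (0 : 0 : 1 : -1).  The projection
     (X0 : X1 : X2 : X3) |-> (X0 : X1 : X3)
   to the closure in P^2 of v^2 = u^4 - 1 is finite, as its centre
   (0 : 0 : 1 : 0) does not lie on E, and it is an isomorphism above the affine
   curve; since E is smooth, it is the normalization of that closure.  See
   E_smooth, plane_closureP, plane_coordsN0 and E_affineP below. *)
Definition on_E (x : 'rV[algC]_4) : bool :=
  (x 0 0 * x 0 (inord 2) == x 0 1 ^+ 2)
  && (x 0 (inord 3) ^+ 2 == x 0 (inord 2) ^+ 2 - x 0 0 ^+ 2).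

Definition E : Type := {p : proj 3 | on_E (rep p)}.

Definition aff (A : nzRingType) (u v : A) (j : 'I_4) : A :=
  [:: 1; u; u ^+ 2; v]`_j.

Definition affv (u v : algC) : 'rV[algC]_4 := \row_j aff u v j.

Lemma proj_line_proof n (x : 'rV[algC]_n.+1) (x0 : x != 0) :
  \dim <[x]>%VS == 1%N.
Proof. by rewrite dim_vline x0. Qed.

Definition line n (x : 'rV[algC]_n.+1) (x0 : x != 0) : proj n :=
  exist _ <[x]>%VS (proj_line_proof x0).

Lemma repN0 n (p : proj n) : rep p != 0.
Proof.
rewrite /rep vpick0; apply/eqP => p0.
by have := valP p; rewrite p0 dimv0.
Qed.

Lemma rep_coords n (p : proj n) : coords p (rep p).
Proof.
apply/esym/eqP; rewrite eqEdim -memvE memv_pick dim_vline repN0.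
by rewrite (eqP (valP p)).
Qed.

Lemma coordsZ n (p : proj n) x : coords p x ->
  exists2 c : algC, c != 0 & rep p = c *: x.
Proof.
move=> px; have : rep p \in <[x]>%VS by rewrite -px memv_pick.
case/vlineP => c Ec; exists c => //; apply: contraNneq (repN0 p) => c0.
by rewrite Ec c0 scale0r.
Qed.

Lemma on_EZ (c : algC) x : c != 0 -> on_E (c *: x) = on_E x.
Proof.
move=> c0; rewrite /on_E !mxE !exprMn mulrACA -expr2 -mulrBr.
by rewrite !(inj_eq (mulfI (expf_neq0 2 c0))).
Qed.

Lemma on_E_line x (x0 : x != 0) : on_E x -> on_E (rep (line x0)).
Proof.
move=> Ex; have [|c c0 ->] := @coordsZ _ (line x0) x; first by [].
by rewrite on_EZ.
Qed.

Lemma affv_neq0 u v : affv u v != 0.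
Proof.
apply/eqP => /rowP /(_ 0); rewrite !mxE /aff /= => /eqP.
by rewrite oner_eq0.
Qed.

Lemma on_E_affv u v : on_E (affv u v) = (v ^+ 2 == u ^+ 4 - 1).
Proof.
by rewrite /on_E !mxE /aff !inordK //= mul1r eqxx expr1n -exprM.
Qed.

Lemma origin_proof : on_E (rep (line (affv_neq0 0 'i))).
Proof.
by apply: on_E_line; rewrite on_E_affv sqrCi expr0n /= sub0r.
Qed.

(* The point (u, v) = (0, i). *)
Definition origin : E := exist _ (line (affv_neq0 0 'i)) origin_proof.

Definition E_eqs (i : 'I_2) : {mpoly algC[4]} :=
  if i == 0 then 'X_0 * 'X_(inord 2) - 'X_1 ^+ 2
  else 'X_(inord 3) ^+ 2 - ('X_(inord 2) ^+ 2 - 'X_0 ^+ 2).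

Lemma E_eqsP (x : 'rV[algC]_4) :
  reflect (forall i, (E_eqs i).@[x 0] = 0) (on_E x).
Proof.
have e1 : (E_eqs 0).@[x 0] = x 0 0 * x 0 (inord 2) - x 0 1 ^+ 2.
  by rewrite /E_eqs /= mevalB mevalM rmorphXn /= !mevalXU.
have e2 : (E_eqs 1).@[x 0] =
    x 0 (inord 3) ^+ 2 - (x 0 (inord 2) ^+ 2 - x 0 0 ^+ 2).
  by rewrite /E_eqs /= !mevalB !rmorphXn /= !mevalXU.
apply: (iffP andP) => [[/eqP z1 /eqP z2] i|z].
  have [->|->] : i = 0 \/ i = 1.
    by case: i => [[|[|i]] lti] //; [left|right]; apply: val_inj.
  - by rewrite e1 z1 subrr.
  - by rewrite e2 z2 subrr.
by rewrite -subr_eq0 -e1 z eqxx -subr_eq0 -e2 z eqxx.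
Qed.

Lemma ord4P (P : 'I_4 -> Prop) :
  P 0 -> P 1 -> P (inord 2) -> P (inord 3) -> forall j, P j.
Proof.
move=> P0 P1 P2 P3 [[|[|[|[|j]]]] lt_j] //.
- by rewrite (_ : Ordinal _ = 0) //; apply: val_inj.
- by rewrite (_ : Ordinal _ = 1) //; apply: val_inj.
- by rewrite (_ : Ordinal _ = inord 2) //; apply: val_inj; rewrite /= inordK.
- by rewrite (_ : Ordinal _ = inord 3) //; apply: val_inj; rewrite /= inordK.
Qed.

Lemma row4_eq0 (x : 'rV[algC]_4) :
  x 0 0 = 0 -> x 0 1 = 0 -> x 0 (inord 2) = 0 -> x 0 (inord 3) = 0 -> x = 0.
Proof. by move=> *; apply/rowP; apply: ord4P; rewrite mxE. Qed.

Lemma mderiv_sqr n (p : {mpoly algC[n]}) i :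
  (p ^+ 2)^`M(i) = 2%:R *: (p * p^`M(i)).
Proof. by rewrite expr2 mderivM [_ * p]mulrC scaler_nat mulr2n. Qed.

Lemma mderiv_var n (i j : 'I_n) :
  ('X_i : {mpoly algC[n]})^`M(j) = (i == j)%:R.
Proof.
rewrite mderivX mnm1E; case: eqP => [->|_]; last by rewrite scale0r.
by rewrite scale1r -[X in (X - _)%MM]add0m addmK mpolyX0.
Qed.

Definition planev (u v : algC) : 'rV[algC]_3 := \row_j [:: 1; u; v]`_j.

(* The Zariski closure in P^2 of the affine curve v^2 = u^4 - 1. *)
Definition on_plane_closure (y : 'rV[algC]_3) : Prop :=
  forall (d : nat) (G : {mpoly algC[3]}), G \is d.-homog ->
    (forall u v, v ^+ 2 = u ^+ 4 - 1 -> G.@[planev u v 0] = 0) ->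
    G.@[y 0] = 0.

Definition plane_coords (x : 'rV[algC]_4) : 'rV[algC]_3 :=
  \row_j [:: x 0 0; x 0 1; x 0 (inord 3)]`_j.

Lemma on_E_infty (x : 'rV[algC]_4) : x != 0 -> on_E x -> x 0 0 = 0 ->
  [/\ x 0 1 = 0, x 0 (inord 2) != 0
    & x 0 (inord 3) ^+ 2 = x 0 (inord 2) ^+ 2].
Proof.
move=> x0 /andP [/eqP e1 /eqP e2] z0.
have z1 : x 0 1 = 0 by apply/eqP; rewrite -sqrf_eq0 -e1 z0 mul0r.
have e3 : x 0 (inord 3) ^+ 2 = x 0 (inord 2) ^+ 2.
  by rewrite e2 z0 expr0n subr0.
split=> //; apply: contraNneq x0 => z2; apply/eqP/row4_eq0 => //.
by apply/eqP; rewrite -sqrf_eq0 e3 z2 expr0n.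
Qed.

(* Jacobian criterion. *)
Lemma E_smooth (x : 'rV[algC]_4) : x != 0 -> on_E x ->
  \rank (\matrix_(i < 2, j < 4) ((E_eqs i)^`M(j)).@[x 0]) = 2.
Proof.
move=> x0 Ex; case/andP: (Ex) => /eqP e1 /eqP e2.
set J := \matrix_(i, j) _; apply/eqP; rewrite -/(row_free _) -kermx_eq0.
apply/rowV0P => c /sub_kermxP cJ.
have JE j : c 0 0 * J 0 j + c 0 1 * J 1 j = 0.
  have /rowP /(_ j) := cJ; rewrite mxE [RHS]mxE !big_ord_recl big_ord0 addr0.
  by rewrite (_ : lift _ _ = 1 :> 'I_2); last exact: val_inj.
have D i j : ((E_eqs i)^`M(j)).@[x 0] =
  if i == 0 then (0 == j)%:R * x 0 (inord 2) + x 0 0 * (inord 2 == j)%:R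
                 - 2 * (x 0 1 * (1 == j)%:R)
  else 2 * (x 0 (inord 3) * (inord 3 == j)%:R)
       - (2 * (x 0 (inord 2) * (inord 2 == j)%:R)
          - 2 * (x 0 0 * (0 == j)%:R)).
  rewrite /E_eqs; case: ifP => _;
    rewrite !mderivB !mderiv_sqr ?mderivM !mderiv_var;
    by rewrite !(mevalB, mevalD, mevalM, mevalZ, mevalXU, rmorph_nat).
have two0 : 2 != 0 :> algC by rewrite pnatr_eq0.
have dj : ((inord 2 == 0 :> 'I_4) = false) * ((inord 2 == 1 :> 'I_4) = false)
  * ((inord 3 == 0 :> 'I_4) = false) * ((inord 3 == 1 :> 'I_4) = false)
  * ((inord 3 == inord 2 :> 'I_4) = false)
  * ((inord 2 == inord 3 :> 'I_4) = false)
  * ((0 == inord 2 :> 'I_4) = false) * ((1 == inord 2 :> 'I_4) = false)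
  * ((0 == inord 3 :> 'I_4) = false) * ((1 == inord 3 :> 'I_4) = false).
  by do !split; apply/eqP => /(congr1 val); rewrite /= ?inordK.
have J0 := JE 0; have J1 := JE 1; have J2 := JE (inord 2).
have J3 := JE (inord 3).
rewrite !mxE !D !eqxx /= !dj !(mulr0, mulr1, mul0r, mul1r, addr0, subr0,
  add0r, sub0r) in J0 J1 J2 J3.
rewrite !(oppr0, opprK, mulr0, addr0) in J0 J1 J2.
have nz := on_E_infty x0 Ex.
have c0 : c 0 0 = 0.
  apply/eqP; apply: contraT => c0.
  have z1 : x 0 1 = 0.
    by apply/eqP; move/eqP: J1; rewrite mulf_eq0 oppr_eq0 mulf_eq0
      (negPf c0) (negPf two0).
  have z0 : x 0 0 = 0.
    move/eqP: e1; rewrite z1 expr0n mulf_eq0 => /orP [/eqP // | /eqP z2].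
    move/eqP: J2; rewrite z2 mulr0 oppr0 mulr0 addr0 mulf_eq0 (negPf c0).
    by move=> /eqP.
  have [_ z2 _] := nz z0; move/eqP: J0.
  by rewrite z0 !mulr0 addr0 mulf_eq0 (negPf c0) (negPf z2).
have c1 : c 0 1 = 0.
  apply/eqP; apply: contraT => c1; move/eqP: J0.
  rewrite c0 mul0r add0r !mulf_eq0 (negPf c1) (negPf two0) => /eqP /nz [_ z2 _].
  move/eqP: J2; rewrite c0 mul0r add0r mulf_eq0 oppr_eq0 mulf_eq0.
  by rewrite (negPf c1) (negPf two0) (negPf z2).
apply/rowP => i; rewrite mxE.
by case: i => [[|[|i]] lti] //; [rewrite -[RHS]c0|rewrite -[RHS]c1];
  congr (c _ _); apply: val_inj.
Qed.

Lemma plane_coordsN0 (x : 'rV[algC]_4) : x != 0 -> on_E x -> plane_coords x != 0.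
Proof.
move=> x0 Ex; apply/eqP => /rowP y0.
have := y0 0; have := y0 (inord 2); rewrite !mxE inordK //= => z3 z0.
have [_ + e] := on_E_infty x0 Ex z0.
by rewrite -sqrf_eq0 -e z3 expr0n eqxx.
Qed.

Lemma E_affineP (x : 'rV[algC]_4) : x 0 0 != 0 ->
  reflect (exists u v, v ^+ 2 = u ^+ 4 - 1 /\ x = x 0 0 *: affv u v) (on_E x).
Proof.
move=> z0; apply: (iffP idP) => [Ex|[u [v [Euv ->]]]]; last first.
  by rewrite on_EZ // on_E_affv Euv.
pose u := x 0 1 / x 0 0; pose v := x 0 (inord 3) / x 0 0.
have Ex' : x = x 0 0 *: affv u v.
  case/andP: (Ex) => /eqP e1 _; apply/rowP; apply: ord4P;
    rewrite !mxE /aff ?inordK //=.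
  - by rewrite mulr1.
  - by rewrite mulrC divfK.
  - by rewrite exprMn -e1; field.
  - by rewrite mulrC divfK.
exists u, v; split=> //; apply/eqP; rewrite -on_E_affv.
by rewrite -(on_EZ _ z0) -Ex'.
Qed.

Lemma mevalZ_homog n d (G : {mpoly algC[n]}) (c : algC) (y : 'I_n -> algC) :
  G \is d.-homog -> G.@[fun j => c * y j] = c ^+ d * G.@[y].
Proof.
move=> /dhomogP hG; rewrite !mevalE mulr_sumr; apply: eq_big_seq => m /hG Em.
rewrite mulrCA; congr (_ * _).
by rewrite -Em /= mdegE -prodrXr -big_split; apply: eq_bigr => i _; rewrite exprMn.
Qed.

Lemma poly_ext0 (r : {poly algC}) : (forall s, r.[s] = 0) -> r = 0.
Proof.
move=> r0; apply/eqP; apply: contraT => rN0.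
pose rs := [seq n%:R : algC | n <- iota 0 (size r)].
have rs0 : all (root r) rs by apply/allP => s _; apply/eqP/r0.
have := max_poly_roots rN0 rs0; rewrite size_map size_iota ltnn; apply.
by rewrite map_inj_uniq ?iota_uniq // => m n /eqP; rewrite eqr_nat => /eqP.
Qed.

(* G vanishes on the points at infinity of E if it does on the affine ones. *)
Lemma E_density (G : {mpoly algC[3]}) (w : algC) :
  (forall s w, s != 0 -> w ^+ 2 = 1 - s ^+ 4 ->
     G.@[fun j => [:: s ^+ 2; s; w]`_j] = 0) ->
  w ^+ 2 = 1 -> G.@[fun j => [:: 0; 0; w]`_j] = 0.
Proof.
move=> hG hw.
pose h (j : 'I_3) : {poly {poly algC}} := [:: ('X^2)%:P; 'X%:P; 'X]`_j.
pose g := mmap (fun c : algC => c%:P%:P) h G.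
have gE s z : g.[z%:P].[s] = G.@[fun j => [:: s ^+ 2; s; z]`_j].
  rewrite /g mevalE /mmap !horner_sum; apply: eq_bigr => m _.
  rewrite /mmap1 !hornerE; congr (_ * _).
  rewrite !big_ord_recl !big_ord0 /h /=.
  by rewrite !hornerE.
pose M : {poly {poly algC}} := 'X^2 - (1 - 'X^4)%:P.
have Mmon : M \is monic by exact: monicXnsubC.
have gM := Pdiv.RingMonic.rdivp_eq Mmon g.
set q := Pdiv.CommonRing.rdivp _ _ in gM.
set r := Pdiv.CommonRing.rmodp _ _ in gM.
have szr : (size r <= 2)%N.
  have szM : size M = 3 by rewrite size_XnsubC.
  have M0 : M != 0 by rewrite -size_poly_eq0 szM.
  by have := Pdiv.CommonRing.ltn_rmodpN0 g M0; rewrite szM.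
have rE z s : r.[z%:P].[s] = (r`_0).[s] + (r`_1).[s] * z.
  rewrite (horner_coef_wide _ szr) !big_ord_recl big_ord0 !hornerE /=.
  by rewrite addr0.
have gr z s : z ^+ 2 = 1 - s ^+ 4 -> g.[z%:P].[s] = (r`_0).[s] + (r`_1).[s] * z.
  move=> Ez; rewrite gM !hornerE /= rE Ez subrr mulr0 add0r //.
have r_eq0 s : s * (1 - s ^+ 4) != 0 -> (r`_0).[s] = 0 /\ (r`_1).[s] = 0.
  rewrite mulf_eq0 negb_or => /andP [s0 s1].
  pose z := sqrtC (1 - s ^+ 4).
  have Ez : z ^+ 2 = 1 - s ^+ 4 by exact: sqrtCK.
  have z0 : z != 0 by rewrite -sqrf_eq0 Ez.
  have e1 : (r`_0).[s] + (r`_1).[s] * z = 0 by rewrite -gr // gE hG.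
  have e2 : (r`_0).[s] - (r`_1).[s] * z = 0.
    by rewrite -mulrN -gr ?sqrrN // gE hG // sqrrN.
  have two0 : 2 != 0 :> algC by rewrite pnatr_eq0.
  have r0 : (r`_0).[s] = 0.
    apply/eqP; rewrite -(mulrI_eq0 _ (mulfI two0)) mulr_natl mulr2n.
    by apply/eqP; rewrite -[RHS]addr0 -{1}e1 -e2; ring.
  split=> //; move/eqP: e1; rewrite r0 add0r mulf_eq0 (negPf z0) orbF.
  by move/eqP.
have mul0 (p : {poly algC}) :
    (forall s, s * (1 - s ^+ 4) != 0 -> p.[s] = 0) -> p = 0.
  move=> p0; have /eqP : p * ('X * (1 - 'X^4)) = 0.
    apply: poly_ext0 => s.
    have -> : (p * ('X * (1 - 'X^4))).[s] = p.[s] * (s * (1 - s ^+ 4)).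
      by rewrite !hornerE.
    have [->|/p0 ->] := eqVneq (s * (1 - s ^+ 4)) 0; first by rewrite mulr0.
    by rewrite mul0r.
  rewrite mulf_eq0 => /orP [/eqP // |]; rewrite mulf_eq0 polyX_eq0 /=.
  by rewrite -oppr_eq0 opprB -size_poly_eq0 size_XnsubC.
have r00 : r`_0 = 0 by apply: mul0 => s /r_eq0 [].
have r10 : r`_1 = 0 by apply: mul0 => s /r_eq0 [].
have := gE 0 w; rewrite gr ?expr0n ?subr0 // r00 r10 !horner0 mul0r addr0.
by [].
Qed.

Lemma plane_closureP (y : 'rV[algC]_3) : y != 0 ->
  on_plane_closure y <-> exists x, [/\ x != 0, on_E x & y = plane_coords x].
Proof.
have ord3P (P : 'I_3 -> Prop) : P 0 -> P 1 -> P (inord 2) -> forall j, P j.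
  move=> P0 P1 P2 [[|[|[|j]]] lt_j] //.
  - by rewrite (_ : Ordinal _ = 0) //; apply: val_inj.
  - by rewrite (_ : Ordinal _ = 1) //; apply: val_inj.
  - by rewrite (_ : Ordinal _ = inord 2) //; apply: val_inj; rewrite /= inordK.
move=> y0; split=> [cl|[x [x0 Ex ->]] d G homG hG]; last first.
  have [z0|z0] := eqVneq (x 0 0) 0; last first.
    have /(_ Ex) [u [v [Euv Ex']]] := elimT (E_affineP z0).
    rewrite (@meval_eq _ _ _ (fun j => x 0 0 * planev u v 0 j)).
      by rewrite (mevalZ_homog _ _ homG) hG ?mulr0.
    apply: ord3P; rewrite !mxE ?inordK //= [in LHS]Ex' !mxE /aff ?inordK //=.
  have [z1 z2 z3] := on_E_infty x0 Ex z0.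
  pose w := x 0 (inord 3) / x 0 (inord 2).
  rewrite (@meval_eq _ _ _
    (fun j => x 0 (inord 2) * (fun j : 'I_3 => [:: 0; 0; w]`_j) j)).
    rewrite (mevalZ_homog _ _ homG) E_density ?mulr0 //; last first.
      by rewrite expr_div_n z3 divff // expf_neq0.
    move=> s t s0 Est.
    rewrite (@meval_eq _ _ _ (fun j => s ^+ 2 * planev s^-1 (t / s ^+ 2) 0 j)).
      rewrite (mevalZ_homog _ _ homG) hG ?mulr0 // expr_div_n Est.
      by field.
    by apply: ord3P; rewrite !mxE ?inordK //=; field.
  apply: ord3P; rewrite !mxE ?inordK //= ?z0 ?z1 ?mulr0 //.
  by rewrite mulrC divfK.
have /eqP : ('X_0 ^+ 2 * 'X_(inord 2) ^+ 2 - 'X_1 ^+ 4 + 'X_0 ^+ 4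
    : {mpoly algC[3]}).@[y 0] = 0.
  have dX (i : 'I_3) m : ('X_i : {mpoly algC[3]}) ^+ m \is m.-homog.
    by rewrite -[m in m.-homog]mul1n dhomogMn // dhomogX; apply/eqP/mdeg1.
  apply: (cl 4%N) => [|u v Euv].
    rewrite rpredD ?dX // rpredB ?dX //.
    by rewrite (_ : 4%N = (2 + 2)%N) // dhomogM.
  rewrite mevalD mevalB mevalM !rmorphXn /= !mevalXU !mxE inordK //= Euv.
  by ring.
rewrite mevalD mevalB mevalM !rmorphXn /= !mevalXU => /eqP Ey.
have [z0|z0] := eqVneq (y 0 0) 0.
  have z1 : y 0 1 = 0.
    move/eqP: Ey; rewrite z0 !expr0n mul0r add0r addr0 oppr_eq0 expf_eq0.
    by move=> /andP [_ /eqP].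
  pose x : 'rV[algC]_4 := \row_j [:: 0; 0; y 0 (inord 2); y 0 (inord 2)]`_j.
  have Exy : y = plane_coords x.
    by apply/rowP; apply: ord3P; rewrite !mxE ?inordK.
  exists x; split=> //.
    by apply: contraNneq y0 => xx; rewrite Exy; apply/eqP/rowP;
      apply: ord3P; rewrite xx !mxE ?inordK.
  by rewrite /on_E !mxE !inordK //= mul0r !expr0n /= subr0 !eqxx.
pose u := y 0 1 / y 0 0; pose v := y 0 (inord 2) / y 0 0.
exists (y 0 0 *: affv u v); split.
- by rewrite scaler_eq0 negb_or z0 affv_neq0.
- rewrite on_EZ // on_E_affv /v /u; apply/eqP.
  rewrite [(_ / _) ^+ 4]expr_div_n.
  have -> : y 0 1 ^+ 4 = y 0 0 ^+ 2 * y 0 (inord 2) ^+ 2 + y 0 0 ^+ 4.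
    by rewrite -[LHS]addr0 -Ey; ring.
  by rewrite expr_div_n; field.
- apply/rowP; apply: ord3P; rewrite !mxE ?inordK //= /aff ?inordK //=.
  + by rewrite mulr1.
  + by rewrite mulrC divfK.
  + by rewrite mulrC divfK.
Qed.

(* phi is a morphism: around every point it is given by homogeneous polynomials
   of the same degree.  (Where F does not vanish, which is an open set, mev F
   is a vector of homogeneous coordinates of the image.) *)
Definition is_morphism (phi : E -> E) : Prop :=
  forall p : E, exists (d : nat) (F : 'I_4 -> {mpoly algC[4]}),
    [/\ forall j, F j \is d.-homog,
        mev F (rep (val p)) != 0
      & forall q : E, mev F (rep (val q)) != 0 ->
          coords (val (phi q)) (mev F (rep (val q)))].

(* The function field \bar Q(E) = \bar Q(u)[v] / (v^2 - (u^4 - 1)). *)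
Definition Efun_poly : {poly {fraction {poly algC}}} :=
  'X^2 - (tofrac ('X^4 - 1))%:P.

Lemma fracE (R : idomainType) (x : {fraction R}) :
  exists2 d : R, d != 0 & exists n : R, x * tofrac d = tofrac n.
Proof.
elim/quotW: x => r; exists \d_r; first exact: denom_ratioP.
exists \n_r; rewrite !piE; apply/eqmodP => /=.
have d0 := denom_ratioP r.
by rewrite /FracField.mulf FracField.equivfE !numden_Ratio
  ?mulf_neq0 ?oner_neq0 // !mulr1 mulrC.
Qed.

Lemma Efun_poly_irr : monic_irreducible_poly Efun_poly.
Proof.
have sz : size Efun_poly = 3 by rewrite size_XnsubC.
split; last exact: monicXnsubC.
apply: cubic_irreducible; first by rewrite sz.
move=> x; apply/negP; rewrite /root !hornerE subr_eq0 => /eqP.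
have [b b0 [a Ex]] := fracE x => Ex2.
have {x Ex Ex2} : a ^+ 2 = ('X^4 - 1) * b ^+ 2.
  apply/eqP; rewrite -tofrac_eq [tofrac (a ^+ 2)]rmorphXn /= -Ex exprMn Ex2.
  by rewrite tofracM tofracXn.
have X41 : 'X^4 - 1 != 0 :> {poly algC}.
  by rewrite -size_poly_eq0 size_XnsubC.
move=> Eab; have a0 : a != 0.
  by rewrite -sqrf_eq0 Eab mulf_neq0 // expf_neq0.
have mu1 : mup 1 ('X^4 - 1 : {poly algC}) = 1%N.
  apply/eqP; rewrite eqn_leq mup_leq // mup_geq // expr1 expr2.
  have -> : 'X^4 - 1 = ('X - 1%:P) * ('X^3 + 'X^2 + 'X + 1) :> {poly algC}.
    by rewrite -[1%:P]/(1 : {poly algC}); ring.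
  rewrite dvdp_mulIl andbT dvdp_mul2l ?polyXsubC_eq0 // dvdp_XsubCl.
  rewrite /root !hornerE !expr1n (_ : _ + _ = 4%:R) ?pnatr_eq0 //; ring.
have /(congr1 odd) := congr1 (mup 1) Eab.
by rewrite !expr2 !mupM ?mulf_neq0 // mu1 !addnn add1n /= !odd_double.
Qed.

Definition Efun : fieldType := {poly %/ Efun_poly with Efun_poly_irr}.

Definition Efun_base (a : {poly algC}) : Efun :=
  qpolyC Efun_poly (tofrac a).
Definition Efun_u : Efun := Efun_base 'X.
Definition Efun_v : Efun := qpolyX Efun_poly.

(* The restriction to E of F, dehomogenized with respect to X0. *)
Definition Efun_res (F : {mpoly algC[4]}) : Efun :=
  mmap (fun c : algC => Efun_base c%:P) (aff Efun_u Efun_v) F.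

(* The rational function g is regular at p and takes the value z there. *)
Definition Efun_value (g : Efun) (p : E) (z : algC) : Prop :=
  exists (d : nat) (F G : {mpoly algC[4]}),
    [/\ F \is d.-homog, G \is d.-homog, G.@[rep (val p) 0] != 0,
        g = Efun_res F / Efun_res G
      & z = F.@[rep (val p) 0] / G.@[rep (val p) 0]].

(* f g = g \o phi for every rational function g. *)
Definition is_pullback (phi : E -> E) (f : {rmorphism Efun -> Efun}) : Prop :=
  forall (g : Efun) (p : E) (z : algC),
    Efun_value g (phi p) z -> Efun_value (f g) p z.

(* [M : f(L)] = d, witnessed by a basis of M over f(L). *)
Definition ext_degree (L M : fieldType) (f : {rmorphism L -> M}) (d : nat) :
    Prop :=
  exists b : 'I_d -> M, forall z : M,
    exists! c : {ffun 'I_d -> L}, z = \sum_(i < d) f (c i) * b i.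

Definition has_degree (phi : E -> E) (d : nat) : Prop :=
  exists2 f : {rmorphism Efun -> Efun}, is_pullback phi f & ext_degree f d.

(* phi is given by (u, v) |-> (u P(t)/Q(t), v R(t)/Q(t)^2) at all affine points
   (u, v) at which t = u^4 / v^2 and these two fractions are defined. *)
Definition induced_by (P Q R : {poly algC}) (phi : E -> E) : Prop :=
  forall (p : E) (u v : algC), coords (val p) (affv u v) ->
    let t := u ^+ 4 / v ^+ 2 in
    v != 0 -> Q.[t] != 0 ->
    coords (val (phi p)) (affv (u * (P.[t] / Q.[t])) (v * (R.[t] / Q.[t] ^+ 2))).

Definition no_multiple_root (S : {poly algC}) : Prop :=
  forall z : algC, (mup z S <= 1)%N.

(* Main.v *)
(* Homogenizing P, Q, R in t = X2^2 / X3^2 turns the map into four forms of degree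
   4k + 1 in the coordinates of P^3.  They have no common zero on E, because P and
   Q have no common root, Q(0) != 0 and P(1) != 0 (t = 1 at the points at
   infinity, t = oo where v = 0); so they define a morphism.  At t = 0 the equation
   gives R(0)^2 = Q(0)^4, and the sign of R is chosen so that R(0) = Q(0)^2.

   For the degree, x = u P(t) / Q(t) = A(u) / B(u) with A and B coprime and
   deg A = 4k + 1 > deg B, so 1, u, ..., u^(4k) is a basis of C(u) over C(x):
   independence by reducing modulo A, generation by Bezout with the equation
   A - x B of u over C(x).  As y is v times an element of C(u), the same elements
   form a basis of C(u, v) over C(x, y). *)

Require Import Defs.
From mathcomp Require Import all_boot all_order all_algebra all_field.
From HB Require Import structures.
From mathcomp Require Import mpoly ring zify.
Local Open Scope ring_scope.
Import GRing.Theory Num.Theory.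

Set Implicit Arguments.
Unset Strict Implicit.
Unset Printing Implicit Defensive.

(** * Substituting a rational fraction *)

(** Universal property of the fraction field. The extension is computed on a chosen fraction; [GE]
    shows that every other fraction gives the same value, so sums and products can be checked on
    convenient denominators. Injectivity keeps the images of denominators nonzero. *)
Lemma frac_lift (R : idomainType) (K : fieldType) (g : {rmorphism R -> K}) :
  injective g ->
  exists G : {rmorphism {fraction R} -> K}, forall a, G (tofrac a) = g a.
Proof.
move=> inj_g; have g_eq0 a : (g a == 0) = (a == 0).
  by rewrite -(inj_eq inj_g) rmorph0.
pose P x (nd : R * R) := (nd.2 != 0) && (x * tofrac nd.2 == tofrac nd.1).
have exP x : exists nd, P x nd.
  have [d d0 [n Ex]] := fracE x.
  by exists (n, d); rewrite /P d0 Ex eqxx.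
pose G x := let nd := xchoose (exP x) in g nd.1 / g nd.2.
have GE x n d : d != 0 -> x * tofrac d = tofrac n -> G x = g n / g d.
  move=> d0 Ex; rewrite /G; case: (xchoose (exP x)) (xchooseP (exP x)) => n' d'.
  case/andP=> /= d'0 /eqP Ex'; apply/eqP.
  rewrite eqr_div ?g_eq0 // -!rmorphM (inj_eq inj_g) -tofrac_eq !rmorphM /=.
  by rewrite -Ex -Ex'; apply/eqP; ring.
have Gadd : zmod_morphism G.
  move=> x y; have [d d0 [n Ex]] := fracE x; have [e e0 [m Ey]] := fracE y.
  rewrite (GE _ _ _ d0 Ex) (GE _ _ _ e0 Ey) (GE _ (n * e - m * d) (d * e)).
  - by rewrite !rmorphB !rmorphM /=; field; rewrite !g_eq0 d0 e0.
  - by rewrite mulf_neq0.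
  - by rewrite rmorphB !rmorphM /= -Ex -Ey; ring.
have Gmul : monoid_morphism G.
  split=> [|x y].
    by rewrite (GE _ 1 1) ?oner_eq0 ?rmorph1 ?divr1 ?mulr1.
  have [d d0 [n Ex]] := fracE x; have [e e0 [m Ey]] := fracE y.
  rewrite (GE _ _ _ d0 Ex) (GE _ _ _ e0 Ey) (GE _ (n * m) (d * e)).
  - by rewrite !rmorphM /=; field; rewrite !g_eq0 d0 e0.
  - by rewrite mulf_neq0.
  - by rewrite !rmorphM /= -Ex -Ey; ring.
pose G' : {rmorphism {fraction R} -> K} := HB.pack G
  (GRing.isZmodMorphism.Build _ _ G Gadd)
  (GRing.isMonoidMorphism.Build _ _ G Gmul).
exists G' => a; rewrite /= (GE _ a 1) ?oner_eq0 ?rmorph1 ?divr1 ?mulr1 //.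
Qed.

(** Evaluation at a root [y] of the image of [h] is unchanged by reduction modulo [h] ([modE]),
    hence passes to the quotient. *)
Lemma qfpoly_lift (L K : fieldType) (h : {poly L})
    (hI : monic_irreducible_poly h) (g : {rmorphism L -> K}) (y : K) :
  root (map_poly g h) y ->
  exists2 G : {rmorphism {poly %/ h with hI} -> K},
    forall a, G (qpolyC h a) = g a & G (qpolyX h) = y.
Proof.
move=> /rootP hy; pose G (p : {poly %/ h with hI}) := (map_poly g (val p)).[y].
have hE : mk_monic h = h := mk_monicE hI.
have modE p : (map_poly g (Pdiv.CommonRing.rmodp p (mk_monic h))).[y]
    = (map_poly g p).[y].
  rewrite [p in RHS](Pdiv.RingMonic.rdivp_eq (monic_mk_monic h)) !hE.
  by rewrite rmorphD rmorphM /= hornerD hornerM hy mulr0 add0r.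
have Gadd : zmod_morphism G by move=> p q; rewrite /G -hornerN -hornerD -rmorphB.
have Gmul : monoid_morphism G.
  split=> [|p q]; first by rewrite /G rmorph1 hornerC.
  by rewrite /G -hornerM -rmorphM /= modE.
pose G' : {rmorphism {poly %/ h with hI} -> K} := HB.pack G
  (GRing.isZmodMorphism.Build _ _ G Gadd)
  (GRing.isMonoidMorphism.Build _ _ G Gmul).
exists G' => [a|]; first by rewrite /= /G /= map_polyC hornerC.
by rewrite /= /G /= modE map_polyX hornerX.
Qed.

(* The form [b ^ N * p (a / b)] of degree [N]; coefficients of [p] beyond [N] are
   dropped. *)
Definition form (F S : nzRingType) (kappa : F -> S) N (p : {poly F}) (a b : S) :=
  \sum_(j < N.+1) kappa p`_j * (a ^+ j * b ^+ (N - j)).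

Lemma rmorph_form (F S T : nzRingType) (f : {rmorphism S -> T})
    (kappa : F -> S) N p a b :
  f (form kappa N p a b) = form (f \o kappa) N p (f a) (f b).
Proof.
rewrite /form rmorph_sum; apply: eq_bigr => j _.
by rewrite !rmorphM !rmorphXn.
Qed.

Lemma formE (F : nzRingType) (S : fieldType) (kappa : {rmorphism F -> S}) N
    (p : {poly F}) a b : (size p <= N.+1)%N -> b != 0 ->
  form kappa N p a b = b ^+ N * (map_poly kappa p).[a / b].
Proof.
move=> sz b0; have szk : (size (map_poly kappa p) <= N.+1)%N.
  exact: leq_trans (size_poly _ _) sz.
rewrite (horner_coef_wide _ szk) mulr_sumr; apply: eq_bigr => j _.
have /expfB_cond -> : ((b == 0)%R + j <= N)%N by rewrite (negPf b0) -ltnS ltn_ord.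
by rewrite coef_map expr_div_n /=; field; rewrite expf_neq0.
Qed.

(* Reduction modulo A kills the coefficient of B ^ N; then divide by A. *)
Lemma form_eq0 (F : fieldType) (A B : {poly F}) N (g : nat -> {poly F}) :
  coprimep A B -> (forall j, size (g j) < size A)%N ->
  \sum_(j < N.+1) g j * (A ^+ j * B ^+ (N - j)) = 0 ->
  forall j, (j <= N)%N -> g j = 0.
Proof.
move=> coAB; elim: N g => [|N IHN] g szg.
  by rewrite big_ord1 !expr0 !mulr1 => g0 j; rewrite leqn0 => /eqP ->.
rewrite big_ord_recl expr0 mul1r subn0.
have -> : \sum_(i < N.+1) g (bump 0 i) * (A ^+ bump 0 i * B ^+ (N.+1 - bump 0 i))
    = A * \sum_(i < N.+1) g i.+1 * (A ^+ i * B ^+ (N - i)).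
  rewrite mulr_sumr; apply: eq_bigr => i _.
  by rewrite /bump add1n subSS exprS; ring.
move=> e.
have g0 : g 0%N = 0.
  apply/eqP; apply: contraLR (szg 0%N) => g0; rewrite -leqNgt dvdp_leq //.
  rewrite -(@Gauss_dvdpl _ _ (B ^+ N.+1)) ?coprimep_expr //.
  move/eqP: e; rewrite addr_eq0 => /eqP ->.
  by rewrite -mulrN dvdp_mulr.
have A0 : A != 0 by rewrite -size_poly_gt0 (leq_ltn_trans _ (szg 0%N)).
move/eqP: e; rewrite g0 mul0r add0r mulf_eq0 (negPf A0) => /eqP e.
by case=> // j; apply: (IHN (fun j => g j.+1)).
Qed.

Section RationalSubstitution.

Variables (F : closedFieldType) (A B : {poly F}) (n : nat).
Hypotheses (coAB : coprimep A B) (szA : size A = n.+2).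
Hypothesis szB : (size B < size A)%N.

Local Notation L := {fraction {poly F}}.
Let kappa : {rmorphism F -> L} := @tofrac {poly F} \o polyC.
Let x : L := tofrac A / tofrac B.

Let B0 : B != 0.
Proof.
by apply: contraTneq coAB => ->; rewrite coprimep0 -size_poly_eq1 szA.
Qed.

Lemma horner_tofrac p : (map_poly kappa p).[tofrac 'X] = tofrac p.
Proof.
rewrite (map_poly_comp (@tofrac _) polyC) horner_map /=; congr tofrac.
exact: comp_polyXr.
Qed.

Lemma form_tofrac N p (U V : {poly F}) :
  form kappa N p (tofrac U) (tofrac V) = tofrac (form polyC N p U V).
Proof. by rewrite rmorph_form. Qed.

(** Multiplying by [B ^ N] turns the relation into one between polynomials. Regrouped by the powers
    of [A], it has coefficients of degree at most [n], less than the degree of [A], so [form_eq0]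
    applies. *)
Lemma rational_substitution_free (c : 'I_n.+1 -> {poly F}) :
  \sum_(i < n.+1) (map_poly kappa (c i)).[x] * tofrac 'X ^+ i = 0 ->
  forall i, c i = 0.
Proof.
move=> e; pose N := \max_(i < n.+1) size (c i).
have szc i : (size (c i) <= N.+1)%N by rewrite ltnW // ltnS leq_bigmax.
have {e} : \sum_(i < n.+1) form polyC N (c i) A B * 'X ^+ i = 0.
  apply/eqP; rewrite -tofrac_eq0 rmorph_sum /=; apply/eqP.
  rewrite -[RHS](mulr0 (tofrac B ^+ N)) -[X in _ = _ * X]e mulr_sumr.
  apply: eq_bigr => i _.
  by rewrite rmorphM rmorphXn /= -form_tofrac formE ?tofrac_eq0 // mulrA.
(* [g j] is the coefficient of [A ^ j * B ^ (N - j)] after exchanging the two sums: its own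
   coefficients are the [j]-th coefficients of the [c i]. *)
pose g j := \poly_(i < n.+1) (c (inord i))`_j.
have gE j : g j = \sum_(i < n.+1) ((c i)`_j)%:P * 'X ^+ i.
  rewrite /g poly_def; apply: eq_bigr => i _.
  by rewrite inord_val mul_polyC.
have -> : \sum_(i < n.+1) form polyC N (c i) A B * 'X ^+ i
    = \sum_(j < N.+1) g j * (A ^+ j * B ^+ (N - j)).
  under eq_bigr do rewrite mulr_suml; rewrite exchange_big.
  apply: eq_bigr => j _; rewrite gE mulr_suml; apply: eq_bigr => i _; ring.
move=> /(form_eq0 coAB) g0 i; apply/polyP => j; rewrite coef0.
have szg j' : (size (g j') < size A)%N by rewrite szA ltnS size_poly.
have [le_jN|lt_Nj] := leqP j N; last by rewrite nth_default // (leq_trans (szc i)).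
have /polyP/(_ i) := g0 szg j le_jN.
by rewrite coef0 coef_poly ltn_ord inord_val.
Qed.

Lemma rational_substitution :
  exists2 sigma : {rmorphism L -> L},
    forall c, sigma (kappa c) = kappa c & sigma (tofrac 'X) = x.
Proof.
pose ev : {rmorphism {poly F} -> L} :=
  horner_eval x \o map_poly kappa.
have inj_ev : injective ev.
  apply: raddf_inj => p; rewrite /= /horner_eval /= => p0.
  (* The fraction [x] is transcendental over [F]: this is the preceding independence with a single
     nonzero [c i]. *)
  pose c (i : 'I_n.+1) := if i == ord0 then p else 0.
  have -> : p = c ord0 by rewrite /c eqxx.
  apply: rational_substitution_free; rewrite big_ord_recl big1 => [|i _].
    by rewrite /c eqxx p0 mul0r addr0.
  by rewrite /c /= map_poly0 horner0 mul0r.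
have [sigma sigmaE] := frac_lift inj_ev.
exists sigma => [c|]; rewrite sigmaE /= /horner_eval /=.
  by rewrite map_polyC hornerC.
by rewrite map_polyX hornerX.
Qed.

Lemma rational_substitution_basis (sigma : {rmorphism L -> L}) :
  (forall c, sigma (kappa c) = kappa c) -> sigma (tofrac 'X) = x ->
  forall z : L, exists! c : {ffun 'I_n.+1 -> L},
    z = \sum_(i < n.+1) sigma (c i) * tofrac 'X ^+ i.
Proof.
move=> sigmaC sigmaX.
have sigmaE p : sigma (tofrac p) = (map_poly kappa p).[x].
  rewrite -horner_tofrac -horner_map sigmaX -map_poly_comp.
  by congr (_.[_]); apply: eq_map_poly => c; exact: sigmaC.
have free (c : 'I_n.+1 -> L) :
    \sum_(i < n.+1) sigma (c i) * tofrac 'X ^+ i = 0 -> forall i, c i = 0.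
  move=> e.
  (* A common denominator [d] of the [c i] reduces independence to polynomial coefficients. *)
  have [d d0 [a Ea]] : exists2 d, d != 0 &
      exists a : 'I_n.+1 -> {poly F}, forall i, c i * tofrac d = tofrac (a i).
    have /fin_all_exists2 [d d0 Ed] i := fracE (c i).
    have /fin_all_exists [a Ea] := Ed.
    exists (\prod_i d i); first by apply/prodf_neq0 => i _.
    exists (fun i => a i * \prod_(j | j != i) d j) => i.
    by rewrite (bigD1 i) //= !rmorphM /= mulrA Ea.
  have a0 : forall i, a i = 0.
    apply: rational_substitution_free; rewrite -[RHS](mulr0 (sigma (tofrac d))).
    rewrite -[X in _ = _ * X]e mulr_sumr; apply: eq_bigr => i _.
    by rewrite -sigmaE -Ea rmorphM /=; ring.
  move=> i; move/eqP: (Ea i).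
  by rewrite a0 rmorph0 mulf_eq0 tofrac_eq0 (negPf d0) orbF => /eqP.
(* The coefficient [tofrac 'X] of [m] is the variable of the source of [sigma]. It becomes
   [x = A / B] once [sigma] is applied, so [m] acquires the root [tofrac 'X] and [ev] kills it. *)
pose m : {poly L} := map_poly kappa A - tofrac 'X *: map_poly kappa B.
have szm : size m = n.+2.
  rewrite size_polyDl size_map_poly // size_polyN.
  by rewrite (leq_ltn_trans (size_scale_leq _ _)) // size_map_poly.
pose ev : {rmorphism {poly L} -> L} := horner_eval (tofrac 'X) \o map_poly sigma.
have evE (p : {poly L}) : (size p <= n.+1)%N ->
    ev p = \sum_(i < n.+1) sigma p`_i * tofrac 'X ^+ i.
  move=> szp; rewrite /ev /= /horner_eval /= (@horner_coef_wide _ n.+1).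
    by apply: eq_bigr => i _; rewrite coef_map.
  by rewrite size_map_poly.
have ev_kappa p : ev (map_poly kappa p) = tofrac p.
  rewrite -horner_tofrac /ev /= /horner_eval -map_poly_comp; congr (_.[_]).
  by apply: eq_map_poly => c; exact: sigmaC.
have evm : ev m = 0.
  rewrite rmorphB -mul_polyC rmorphM !ev_kappa /= /horner_eval map_polyC hornerC.
  by rewrite /= sigmaX /x divfK ?subrr // tofrac_eq0.
(* F is algebraically closed, and A - x B has no root in it: A and B would both
   vanish there. *)
have com g : g != 0 -> coprimep (map_poly kappa g) m.
  move=> g0; have [r gE] := closed_field_poly_normal g.
  rewrite gE map_polyZ coprimepZl ?fmorph_eq0 ?lead_coef_eq0 //.
  elim: r {gE} => [|z r IHr]; first by rewrite big_nil rmorph1 coprime1p.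
  rewrite big_cons rmorphM coprimepMl IHr andbT /= map_polyXsubC.
  rewrite coprimep_sym coprimep_XsubC; apply/negP => /rootP.
  rewrite hornerD hornerN hornerZ !horner_map /= -tofracM -tofracB => /eqP.
  (* The coefficients of degree 0 and 1 of [A(z) - B(z) X] are [A(z)] and [-B(z)]. *)
  rewrite tofrac_eq0 => /eqP/polyP ez; have := ez 1%N; have := ez 0%N.
  rewrite !(coef0, coefB, coefC, coefXM) /= subr0 sub0r => /eqP Az /eqP.
  by rewrite oppr_eq0; exact/negP/(coprimep_root coAB).
move=> z; have [g g0 [p Ez]] := fracE z.
have /Bezout_eq1_coprimepP [[a b] /= eab] := com _ g0.
(* [a] inverts [g] modulo [m], so [ev] maps [p * a] to [p / g = z]; reducing modulo [m] keeps this
   value and brings the degree down to at most [n]. *)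
pose q : {poly L} := (map_poly kappa p * a) %% m.
have szq : (size q <= n.+1)%N.
  by rewrite -ltnS -szm ltn_modp -size_poly_gt0 szm.
have evz : ev q = z.
  have eag : ev a * tofrac g = 1.
    by rewrite -ev_kappa -rmorphM -[RHS](rmorph1 ev) -eab rmorphD !rmorphM
      evm mulr0 addr0.
  apply: (mulIf (_ : tofrac g != 0)); first by rewrite tofrac_eq0.
  have /(congr1 ev) := divp_eq (map_poly kappa p * a) m.
  rewrite rmorphD !rmorphM evm mulr0 add0r ev_kappa => <-.
  by rewrite -mulrA eag mulr1 Ez.
exists [ffun i : 'I_n.+1 => q`_i]; split=> [|c Ec].
  by rewrite -[LHS]evz evE //; apply: eq_bigr => i _; rewrite ffunE.
apply/ffunP => i; apply/eqP; rewrite ffunE -subr_eq0; apply/eqP.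
apply: (free (fun i : 'I_n.+1 => q`_i - c i)).
rewrite -[RHS](subrr z) -[X in _ = X - _]evz evE // [X in _ = _ - X]Ec -sumrB.
by apply: eq_bigr => j _; rewrite rmorphB mulrBl.
Qed.

End RationalSubstitution.

(** [K] is the direct sum of [L] and [L v], and [f] respects it, acting as [sigma] on the first
    summand and as [r] times [sigma] on the second. As [r] is invertible, a basis of [L] over
    [sigma(L)] gives the coordinates in both summands at once. *)
Lemma quadratic_ext_degree (L K : fieldType) (iota : {rmorphism L -> K}) (v : K)
    (sigma : {rmorphism L -> L}) (r : L) (f : {rmorphism K -> K}) n (b : 'I_n -> L) :
  (forall z, exists p q, z = iota p + iota q * v) ->
  (forall p q p' q', iota p + iota q * v = iota p' + iota q' * v ->
     p = p' /\ q = q') ->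
  r != 0 -> (forall a, f (iota a) = iota (sigma a)) -> f v = iota r * v ->
  (forall z, exists! c : {ffun 'I_n -> L}, z = \sum_(i < n) sigma (c i) * b i) ->
  ext_degree f n.
Proof.
move=> span free r0 fC fv basis; exists (fun i => iota (b i)) => z.
have sumE (c : 'I_n -> K) (p q : 'I_n -> L) :
    (forall i, c i = iota (p i) + iota (q i) * v) ->
    \sum_(i < n) f (c i) * iota (b i) =
      iota (\sum_(i < n) sigma (p i) * b i)
      + iota (r * \sum_(i < n) sigma (q i) * b i) * v.
  move=> Ec; rewrite mulr_sumr !rmorph_sum mulr_suml -big_split /=.
  apply: eq_bigr => i _; rewrite Ec rmorphD rmorphM !fC fv !rmorphM /=; ring.
have [p [q ->]] := span z.
have [cp [Ecp Ucp]] := basis p; have [cq [Ecq Ucq]] := basis (q / r).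
exists [ffun i => iota (cp i) + iota (cq i) * v]; split=> [|c Ec].
  rewrite (sumE _ cp cq) => [|i]; last by rewrite ffunE.
  by rewrite -Ecp -Ecq mulrCA divff // mulr1.
have /fin_all_exists [p' /fin_all_exists [q' Ec']] i := span (c i).
move: Ec; rewrite (sumE _ _ _ Ec') => /free [Ep Eq].
have Ecp' : cp = [ffun i => p' i].
  by apply: Ucp; rewrite Ep; apply: eq_bigr => i _; rewrite ffunE.
have Ecq' : cq = [ffun i => q' i].
  apply: Ucq; rewrite Eq mulrAC mulfV // mul1r.
  by apply: eq_bigr => i _; rewrite ffunE.
by apply/ffunP => i; rewrite Ec' ffunE Ecp' Ecq' !ffunE.
Qed.

(** * The function field of E *)

HB.instance Definition _ :=
  GRing.RMorphism.copy Efun_base (qpolyC Efun_poly \o @tofrac _).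

Definition Efun_const : algC -> Efun := Efun_base \o polyC.
HB.instance Definition _ :=
  GRing.RMorphism.copy Efun_const (Efun_base \o polyC).

Local Notation Cu := {fraction {poly algC}}.
Definition Efun_frac : Cu -> Efun := qpolyC Efun_poly.
HB.instance Definition _ := GRing.RMorphism.copy Efun_frac (qpolyC Efun_poly).

Lemma Efun_frac_tofrac a : Efun_frac (tofrac a) = Efun_base a.
Proof. by []. Qed.

Lemma size_Efun_poly : size Efun_poly = 3%N.
Proof. exact: size_XnsubC. Qed.

Lemma val_in_Efun_poly (p : {poly Cu}) :
  (size p <= 2)%N -> in_qpoly Efun_poly p = p :> {poly Cu}.
Proof.
by move=> szp; rewrite in_qpoly_small ?(mk_monicE Efun_poly_irr) ?size_Efun_poly.
Qed.

Lemma Efun_fracE (a : Cu) : Efun_frac a = in_qpoly Efun_poly a%:P.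
Proof.
apply: val_inj; apply/esym/val_in_Efun_poly.
exact: leq_trans (size_polyC_leq1 a) _.
Qed.

Lemma Efun_v2 : Efun_v ^+ 2 = Efun_base ('X^4 - 1).
Proof.
have h0 : in_qpoly Efun_poly Efun_poly = 0.
  apply: val_inj; rewrite /= (mk_monicE Efun_poly_irr).
  by rewrite Pdiv.RingMonic.rmodpp // Efun_poly_irr.
rewrite -[RHS]Efun_frac_tofrac Efun_fracE -[RHS]add0r -{1}h0.
have -> : Efun_v ^+ 2 = in_qpoly Efun_poly ('X ^+ 2) by rewrite rmorphXn.
by rewrite -(rmorphD (in_qpoly Efun_poly)) subrK.
Qed.

Lemma Efun_decompE p q :
  Efun_frac p + Efun_frac q * Efun_v = in_qpoly Efun_poly (p%:P + q%:P * 'X).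
Proof.
by rewrite (rmorphD (in_qpoly Efun_poly)) (rmorphM (in_qpoly Efun_poly)) !Efun_fracE.
Qed.

(** Elements of the quotient are stored as remainders modulo a polynomial of degree 2, so the two
    coordinates are the coefficients of the remainder. Together with [Efun_decomp_inj] this provides
    the direct sum needed by [quadratic_ext_degree]. *)
Lemma Efun_decomp (z : Efun) :
  exists p q, z = Efun_frac p + Efun_frac q * Efun_v.
Proof.
have szz : (size (val z) <= 2)%N.
  rewrite -ltnS; apply: leq_trans (size_mk_monic z) _.
  by rewrite (mk_monicE Efun_poly_irr) size_Efun_poly.
exists (val z)`_0, (val z)`_1; rewrite Efun_decompE; apply: val_inj.
have Ez : val z = ((val z)`_0)%:P + ((val z)`_1)%:P * 'X.
  apply/polyP => i; rewrite coefD coefC coefCM coefX.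
  case: i => [|[|i]]; rewrite ?mulr0 ?mulr1 ?addr0 ?add0r //.
  by rewrite nth_default // (leq_trans szz).
by rewrite [LHS]Ez; apply/esym/val_in_Efun_poly; rewrite -Ez.
Qed.

Lemma polyC_mulX_inj (S : nzRingType) (a b a' b' : S) :
  a%:P + b%:P * 'X = a'%:P + b'%:P * 'X -> a = a' /\ b = b'.
Proof.
move=> /polyP e; have := e 1%N; have := e 0%N.
by rewrite !(coefD, coefC, coefCM, coefX) !(mulr0, mulr1, addr0, add0r).
Qed.

Lemma Efun_decomp_inj p q p' q' :
  Efun_frac p + Efun_frac q * Efun_v = Efun_frac p' + Efun_frac q' * Efun_v ->
  p = p' /\ q = q'.
Proof.
have sz (a b : Cu) : (size (a%:P + b%:P * 'X : {poly Cu})%R <= 2)%N.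
  apply/leq_sizeP => i; rewrite coefD coefC coefCM coefX.
  by case: i => [|[|i]]; rewrite ?mulr0 ?addr0.
rewrite !Efun_decompE => /(congr1 (@qpoly.polyn _ _)) E1.
apply: polyC_mulX_inj.
exact: etrans (etrans (esym (val_in_Efun_poly (sz p q))) E1)
  (val_in_Efun_poly (sz p' q')).
Qed.

(** The hypothesis says exactly that [r v] is a square root of the image of [u^4 - 1], that is, a
    root of the image of [Efun_poly]. *)
Lemma Efun_lift (sigma : {rmorphism Cu -> Cu}) (r : Cu) :
  r ^+ 2 * tofrac ('X^4 - 1) = sigma (tofrac ('X^4 - 1)) ->
  exists2 f : {rmorphism Efun -> Efun},
    forall a, f (Efun_frac a) = Efun_frac (sigma a)
    & f Efun_v = Efun_frac r * Efun_v.
Proof.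
move=> Er; pose g : {rmorphism Cu -> Efun} := Efun_frac \o sigma.
have [|f fC fX] := @qfpoly_lift _ _ _ Efun_poly_irr g (Efun_frac r * Efun_v).
  rewrite /root rmorphB /= map_polyXn map_polyC !hornerE exprMn Efun_v2 /=.
  by rewrite -Efun_frac_tofrac -rmorphXn -rmorphM Er subrr.
by exists f.
Qed.

Lemma Efun_lift_degree (sigma : {rmorphism Cu -> Cu}) (r : Cu)
    (f : {rmorphism Efun -> Efun}) n (b : 'I_n -> Cu) :
  r != 0 -> (forall a, f (Efun_frac a) = Efun_frac (sigma a)) ->
  f Efun_v = Efun_frac r * Efun_v ->
  (forall z, exists! c : {ffun 'I_n -> Cu}, z = \sum_(i < n) sigma (c i) * b i) ->
  ext_degree f n.
Proof. exact: (quadratic_ext_degree Efun_decomp Efun_decomp_inj). Qed.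

(** * The map in homogeneous coordinates *)

Lemma coef_last_neq0 (F : nzRingType) (p : {poly F}) N : size p = N.+1 -> p`_N != 0.
Proof.
move=> szp; have -> : p`_N = lead_coef p by rewrite lead_coefE szp.
by rewrite lead_coef_eq0 -size_poly_gt0 szp.
Qed.

(** The value at [t = oo], where only the top coefficient survives. *)
Lemma form_b0 (F S : nzRingType) (kappa : F -> S) N (p : {poly F}) a :
  form kappa N p a 0 = kappa p`_N * a ^+ N.
Proof.
rewrite /form big_ord_recr big1 /= => [|j _]; last first.
  by rewrite [0 ^+ _]expr0n subn_eq0 leqNgt ltn_ord !mulr0.
by rewrite subnn mulr1 add0r.
Qed.

(** The given identity homogenized in [t = a / b]. At [b = 0] it reduces to the equality of the
    fourth powers of the leading coefficients of [P] and [Q], which holds because [R ^ 2] has degree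
    [4k], too small to contribute in degree [4k + 1]. *)
Lemma form_curve_eq (k : nat) (P Q R : {poly algC}) (a b : algC) :
  'X * P ^+ 4 = ('X - 1) * Q ^+ 4 + R ^+ 2 ->
  size P = k.+1 -> size Q = k.+1 -> size R = (2 * k).+1%N ->
  b * form idfun (2 * k) R a b ^+ 2 =
    a * form idfun k P a b ^+ 4 - (a - b) * form idfun k Q a b ^+ 4.
Proof.
move=> hPQR degP degQ degR.
have [->|b0] := eqVneq b 0.
  have PQ : P`_k ^+ 4 = Q`_k ^+ 4.
    have szX1 : size ('X - 1 : {poly algC}) = 2%N by rewrite size_XsubC.
    have lP : lead_coef P = P`_k by rewrite lead_coefE degP.
    have lQ : lead_coef Q = Q`_k by rewrite lead_coefE degQ.
    have Q0 : Q != 0 by rewrite -size_poly_gt0 degQ.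
    have /(congr1 lead_coef) := hPQR.
    rewrite lead_coefDl; last first.
      rewrite (@size_mul _ ('X - 1)) ?expf_neq0 // -?size_poly_gt0 ?szX1 //.
      have : (0 < size (Q ^+ 4))%N by rewrite size_poly_gt0 expf_neq0.
      have := size_exp Q 4; have := size_exp R 2; rewrite degQ degR.
      move: (size (R ^+ 2)) (size (Q ^+ 4)) => s s'; lia.
    rewrite (lead_coefM 'X) (lead_coefM ('X - 1)) !lead_coef_exp lP lQ.
    by rewrite lead_coefX (lead_coefXsubC 1) !mul1r.
  by rewrite !form_b0 mul0r subr0 !exprMn PQ subrr.
rewrite !formE ?degP ?degQ ?degR //= !map_poly_id //.
have /(congr1 (fun p => p.[a / b])) := hPQR.
rewrite !(horner_exp, hornerM, hornerD, hornerN, hornerX) hornerC => e.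
have {}e : R.[a / b] ^+ 2 = a / b * P.[a / b] ^+ 4 - (a / b - 1) * Q.[a / b] ^+ 4.
  by rewrite e; ring.
rewrite !exprMn e -!exprM (_ : 2 * k * 2 = k * 4)%N; last by lia.
by field.
Qed.

(** A common root of [U] and [V] would be a double root of [S]. *)
Lemma no_multiple_root_factors (S U V : {poly algC}) z :
  no_multiple_root S -> S != 0 -> U * V %| S -> root U z -> V.[z] != 0.
Proof.
move=> simpleS S0 dvdS rU; apply/negP => rV; have := simpleS z; apply/negP.
rewrite -ltnNge mup_geq //; apply: dvdp_trans dvdS.
by rewrite expr2 dvdp_mul // dvdp_XsubCl.
Qed.

(* On E, t = u^4 / v^2 = X2^2 / X3^2; clearing denominators in (1 : x : x^2 : y)
   gives the following forms of degree 4k + 1. *)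
Definition Phi (S : comNzRingType) (kappa : algC -> S) (k : nat)
    (P Q R : {poly algC}) (X : 'I_4 -> S) : 'I_4 -> S :=
  let a := X (inord 2) ^+ 2 in let b := X (inord 3) ^+ 2 in
  let p := form kappa k P a b in let q := form kappa k Q a b in
  fun j => [:: X 0 * q ^+ 2; X 1 * p * q; X (inord 2) * p ^+ 2;
               X (inord 3) * form kappa (2 * k) R a b]`_j.

Lemma rmorph_Phi (S T : comNzRingType) (f : {rmorphism S -> T}) kappa k P Q R X j :
  f (Phi kappa k P Q R X j) = Phi (f \o kappa) k P Q R (f \o X) j.
Proof.
rewrite /Phi; move: j; apply: ord4P; rewrite ?inordK //= !rmorphM ?rmorphXn /=;
  by rewrite !rmorph_form ?rmorphXn.
Qed.

(** Recovers the affine formula of the theorem from the forms, over any field: it serves both at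
    points of the curve and at the generic point [(u, v)] of the function field. *)
Lemma Phi_aff (K : fieldType) (kappa : algC -> K) k P Q R u v j :
  let p := form kappa k P ((u ^+ 2) ^+ 2) (v ^+ 2) in
  let q := form kappa k Q ((u ^+ 2) ^+ 2) (v ^+ 2) in
  let r := form kappa (2 * k) R ((u ^+ 2) ^+ 2) (v ^+ 2) in
  q != 0 ->
  Phi kappa k P Q R (aff u v) j = q ^+ 2 * aff (u * (p / q)) (v * (r / q ^+ 2)) j.
Proof.
move=> p q r q0.
have a2 : aff u v (inord 2) = u ^+ 2 by rewrite /aff inordK.
have a3 : aff u v (inord 3) = v by rewrite /aff inordK.
rewrite /Phi a2 a3 -/p -/q -/r; move: j; apply: ord4P; rewrite /aff ?inordK //=;
  by field.
Qed.

Definition Phi_mpoly k (P Q R : {poly algC}) : 'I_4 -> {mpoly algC[4]} :=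
  Phi (@mpolyC 4 _) k P Q R (fun j => 'X_j).

Lemma eq_form (F S : nzRingType) (kappa kappa' : F -> S) N p a b :
  kappa =1 kappa' -> form kappa N p a b = form kappa' N p a b.
Proof. by move=> ek; apply: eq_bigr => j _; rewrite ek. Qed.

Lemma eq_Phi (S : comNzRingType) (kappa kappa' : algC -> S) k P Q R X X' :
  kappa =1 kappa' -> X =1 X' -> Phi kappa k P Q R X =1 Phi kappa' k P Q R X'.
Proof.
by move=> ek eX j; rewrite /Phi !eX !(eq_form _ _ _ _ ek).
Qed.

Lemma mev_Phi k P Q R (x : 'rV[algC]_4) :
  mev (Phi_mpoly k P Q R) x = \row_j Phi idfun k P Q R (x 0) j.
Proof.
apply/rowP => j; rewrite !mxE /Phi_mpoly rmorph_Phi.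
by apply: eq_Phi => [c|i] /=; rewrite ?mevalC ?mevalXU.
Qed.

Lemma dhomog_form n k (P : {poly algC}) (a b : {mpoly algC[n]}) e :
  a \is e.-homog -> b \is e.-homog -> form (@mpolyC n _) k P a b \is (e * k).-homog.
Proof.
move=> ha hb; apply: rpred_sum => j _; rewrite mul_mpolyC; apply: rpredZ.
have -> : (e * k = e * j + e * (k - j))%N by rewrite -mulnDr subnKC // -ltnS ltn_ord.
by apply: dhomogM; apply: dhomogMn.
Qed.

Lemma dhomog_Phi k P Q R j : Phi_mpoly k P Q R j \is (4 * k + 1).-homog.
Proof.
have hX i : 'X_i \is [in algC[4], 1.-homog] by rewrite dhomogX; apply/eqP/mdeg1.
have hX2 i : 'X_i ^+ 2 \is [in algC[4], 2.-homog] by rewrite (dhomogMn 2 (hX i)).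
rewrite /Phi_mpoly /Phi; set a := 'X_(inord 2) ^+ 2; set b := 'X_(inord 3) ^+ 2.
have hform N S := @dhomog_form 4 N S a b 2 (hX2 _) (hX2 _).
move: j; apply: ord4P; rewrite ?inordK //=.
- rewrite (_ : 4 * k + 1 = 1 + 2 * k * 2)%N; last by lia.
  by apply: dhomogM (hX _) _; apply: dhomogMn.
- rewrite (_ : 4 * k + 1 = 1 + 2 * k + 2 * k)%N; last by lia.
  by apply: dhomogM => //; apply: dhomogM.
- rewrite (_ : 4 * k + 1 = 1 + 2 * k * 2)%N; last by lia.
  by apply: dhomogM (hX _) _; apply: dhomogMn.
- rewrite (_ : 4 * k + 1 = 1 + 2 * (2 * k))%N; last by lia.
  exact: dhomogM.
Qed.

Lemma dhomog_prodX n (I : Type) (s : seq I) (F : I -> {mpoly algC[n]}) (m : I -> nat) e :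
  (forall i, F i \is e.-homog) ->
  \prod_(i <- s) F i ^+ m i \is (e * \sum_(i <- s) m i).-homog.
Proof.
move=> hF; elim: s => [|i s IHs]; first by rewrite !big_nil muln0 dhomog1.
by rewrite !big_cons mulnDr; apply: dhomogM => //; apply: dhomogMn.
Qed.

Lemma dhomog_comp_mpoly n m d e (F : {mpoly algC[n]}) (lq : n.-tuple {mpoly algC[m]}) :
  F \is d.-homog -> (forall i, tnth lq i \is e.-homog) ->
  F \mPo lq \is (e * d).-homog.
Proof.
move=> /dhomogP hF hlq; rewrite comp_mpolyE big_seq; apply: rpred_sum => i /hF <-.
by apply: rpredZ; rewrite /= mdegE; apply: dhomog_prodX.
Qed.

Lemma mmap_homogZ n d (K : comNzRingType) (kappa : algC -> K)
    (G : {mpoly algC[n]}) (c : K) (h : 'I_n -> K) : G \is d.-homog ->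
  mmap kappa (fun j => c * h j) G = c ^+ d * mmap kappa h G.
Proof.
move=> /dhomogP hG; rewrite /mmap mulr_sumr; apply: eq_big_seq => m /hG <-.
rewrite mulrCA; congr (_ * _); rewrite /= mdegE -prodrXr -big_split.
by apply: eq_bigr => i _; rewrite exprMn.
Qed.

Lemma eq_mmap n (S T : nzRingType) (f f' : S -> T) (h h' : 'I_n -> T) :
  f =1 f' -> h =1 h' -> mmap f h =1 mmap f' h'.
Proof.
move=> ef eh G; apply: eq_bigr => m _; rewrite ef; congr (_ * _).
exact: mmap1_eq.
Qed.

Lemma rmorph_mmap n (F S T : nzRingType) (f : {rmorphism S -> T}) (kappa : F -> S)
    (h : 'I_n -> S) G : f (mmap kappa h G) = mmap (f \o kappa) (f \o h) G.
Proof.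
rewrite rmorph_sum; apply: eq_bigr => m _; rewrite rmorphM rmorph_prod.
by congr (_ * _); apply: eq_bigr => i _; rewrite rmorphXn.
Qed.

(** On [E] one has [X2^2 - X3^2 = X0^2], so [form_curve_eq] at [a = X2^2], [b = X3^2] is the second
    quadric for the image; the first follows from [X0 X2 = X1^2]. *)
Lemma Phi_on_E k (P Q R : {poly algC}) (x : 'rV[algC]_4) :
  'X * P ^+ 4 = ('X - 1) * Q ^+ 4 + R ^+ 2 ->
  size P = k.+1 -> size Q = k.+1 -> size R = (2 * k).+1%N ->
  on_E x -> on_E (mev (Phi_mpoly k P Q R) x).
Proof.
move=> hPQR degP degQ degR /andP [/eqP e1 /eqP e2].
have := form_curve_eq (x 0 (inord 2) ^+ 2) (x 0 (inord 3) ^+ 2) hPQR degP degQ degR.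
rewrite mev_Phi /on_E !mxE /Phi !inordK //=.
set p := form _ _ P _ _; set q := form _ _ Q _ _; set r := form _ _ R _ _ => e3.
apply/andP; split; apply/eqP.
  by rewrite mulrACA e1; ring.
have e0 : x 0 (inord 2) ^+ 2 - x 0 (inord 3) ^+ 2 = x 0 0 ^+ 2 by rewrite e2; ring.
by rewrite exprMn e3 e0; ring.
Qed.

(** The components [X0 q^2] and [X2 p^2] alone cannot vanish together on [E]. *)
Lemma Phi_neq0 k (P Q R : {poly algC}) (x : 'rV[algC]_4) :
  size P = k.+1 -> size Q = k.+1 ->
  Q.[0] != 0 -> P.[1] != 0 -> (forall z, root Q z -> P.[z] != 0) ->
  x != 0 -> on_E x -> mev (Phi_mpoly k P Q R) x != 0.
Proof.
move=> degP degQ Q0 P1 coQP x0 Ex; apply/eqP => /rowP e.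
have := e (inord 2); have := e 0; rewrite mev_Phi !mxE /Phi !inordK //=.
set a := x 0 (inord 2) ^+ 2; set b := x 0 (inord 3) ^+ 2.
set p := form _ _ P _ _; set q := form _ _ Q _ _.
move/eqP; rewrite mulf_eq0 sqrf_eq0 => X0q /eqP; rewrite mulf_eq0 sqrf_eq0 => X2p.
have [q0|q0] := eqVneq q 0; last first.
  (* Here [X0 = 0]: a point at infinity, with [a = b], hence [t = 1] and [p = a^k P(1)]. *)
  move: X0q; rewrite (negPf q0) orbF => /eqP /(on_E_infty x0 Ex) [_ X2 eab].
  have a0 : a != 0 by rewrite sqrf_eq0.
  move: X2p; rewrite (negPf X2) /= /p -/a /b eab -/a formE ?degP // map_poly_id //.
  by rewrite divff // mulf_eq0 (negPf P1) orbF expf_eq0 (negPf a0) andbF.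
(* At [b = 0] the form [q] would be the leading coefficient of [Q] times [a^k], and [a = 0] is
   excluded since all coordinates would then vanish. *)
have b0 : b != 0.
  apply/eqP => b0; move/eqP: q0; apply/negP.
  rewrite /q b0 form_b0 mulf_neq0 ?coef_last_neq0 // expf_neq0 // sqrf_eq0.
  case/andP: Ex => /eqP e1 /eqP e2; apply: contraNneq x0 => X2.
  have X3 : x 0 (inord 3) = 0 by apply/eqP; rewrite -sqrf_eq0 -/b b0.
  have X0 : x 0 0 = 0.
    apply/eqP; rewrite -sqrf_eq0 -oppr_eq0; apply/eqP.
    by move: e2; rewrite X2 X3 expr0n /= sub0r => <-.
  have X1 : x 0 1 = 0 by apply/eqP; rewrite -sqrf_eq0 -e1 X2 mulr0.
  exact/eqP/row4_eq0.
have bk0 : b ^+ k != 0 by rewrite expf_neq0.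
have rQ : root Q (a / b).
  by move/eqP: q0; rewrite /q formE ?degQ // map_poly_id // mulf_eq0 (negPf bk0).
move: X2p; rewrite /p formE ?degP // map_poly_id // mulf_eq0 (negPf bk0) /=.
(* [P] is nonzero at the root [a / b] of [Q], so [X2 = 0]; this root is then 0, against
   [Q(0) != 0]. *)
rewrite (negPf (coQP _ rQ)) orbF => /eqP X2.
by move: Q0; move: rQ; rewrite /a X2 expr0n mul0r => /rootP ->; rewrite eqxx.
Qed.

(** * Pullback of rational functions along the map *)

Lemma rmorph_aff (S T : nzRingType) (f : {rmorphism S -> T}) u v j :
  f (aff u v j) = aff (f u) (f v) j.
Proof.
by move: j; apply: ord4P; rewrite /aff ?inordK //= ?rmorph1 ?rmorphXn.
Qed.

Definition Phi_tuple k (P Q R : {poly algC}) := [tuple Phi_mpoly k P Q R j | j < 4].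

Lemma tnth_Phi_tuple k (P Q R : {poly algC}) j :
  tnth (Phi_tuple k P Q R) j = Phi_mpoly k P Q R j.
Proof. by rewrite tnth_map tnth_ord_tuple. Qed.

(** By [Phi_aff] the forms at [(u, v)] are [q^2] times the coordinates of [(f u, f v)], and a form
    [H] of degree [d] turns this factor into its [d]-th power. *)
Lemma mmap_Phi (K : fieldType) (kappa : {rmorphism algC -> K})
    (f : {rmorphism K -> K}) u v k (P Q R : {poly algC}) d (H : {mpoly algC[4]}) :
  let p := form kappa k P ((u ^+ 2) ^+ 2) (v ^+ 2) in
  let q := form kappa k Q ((u ^+ 2) ^+ 2) (v ^+ 2) in
  let r := form kappa (2 * k) R ((u ^+ 2) ^+ 2) (v ^+ 2) in
  q != 0 -> f \o kappa =1 kappa ->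
  f u = u * (p / q) -> f v = v * (r / q ^+ 2) -> H \is d.-homog ->
  mmap kappa (aff u v) (H \mPo Phi_tuple k P Q R)
    = (q ^+ 2) ^+ d * f (mmap kappa (aff u v) H).
Proof.
move=> p q r q0 fC fu fv hH; rewrite [f _]rmorph_mmap.
rewrite [LHS](@rmorph_mmap _ _ _ _ (mmap kappa (aff u v))).
rewrite -mmap_homogZ //; apply: eq_mmap => [b|j] /=.
  by rewrite mmapC; exact/esym/fC.
rewrite tnth_Phi_tuple rmorph_Phi rmorph_aff fu fv -Phi_aff //.
apply: eq_Phi => [b|i] /=; first by rewrite mmapC.
by rewrite mmapX mmap1U.
Qed.

(** If [F / G] represents a function near [phi x], composing both forms with [Phi] represents its
    pullback near [x]. The scaling factors, [c ^ d] for values and [(q ^ 2) ^ d] in the function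
    field, are common to numerator and denominator and cancel. *)
Lemma Phi_pullback k (P Q R : {poly algC}) (phi : E -> E)
    (f : {rmorphism Efun -> Efun}) :
  let p := form Efun_const k P ((Efun_u ^+ 2) ^+ 2) (Efun_v ^+ 2) in
  let q := form Efun_const k Q ((Efun_u ^+ 2) ^+ 2) (Efun_v ^+ 2) in
  let r := form Efun_const (2 * k) R ((Efun_u ^+ 2) ^+ 2) (Efun_v ^+ 2) in
  q != 0 -> f \o Efun_const =1 Efun_const ->
  f Efun_u = Efun_u * (p / q) -> f Efun_v = Efun_v * (r / q ^+ 2) ->
  (forall x, coords (val (phi x)) (mev (Phi_mpoly k P Q R) (rep (val x)))) ->
  is_pullback phi f.
Proof.
move=> p q r q0 fC fu fv phiE _ x _ [d [F [G [hF hG G0 -> ->]]]].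
pose lq := Phi_tuple k P Q R.
have lqE j : tnth lq j = Phi_mpoly k P Q R j := tnth_Phi_tuple k P Q R j.
have hcomp H : H \is d.-homog -> H \mPo lq \is ((4 * k + 1) * d).-homog.
  by move=> hH; apply: dhomog_comp_mpoly => // j; rewrite lqE dhomog_Phi.
have [c c0 Ec] := coordsZ (phiE x).
have evE H : H \is d.-homog ->
    H.@[rep (val (phi x)) 0] = c ^+ d * (H \mPo lq).@[rep (val x) 0].
  move=> hH; rewrite comp_mpoly_meval -mevalZ_homog //; apply: meval_eq => j.
  by rewrite Ec !mxE lqE.
have resE H : H \is d.-homog ->
    Efun_res (H \mPo lq) = (q ^+ 2) ^+ d * f (Efun_res H).
  exact: (mmap_Phi (kappa := Efun_const)).
have q2d : (q ^+ 2) ^+ d != 0 by rewrite !expf_neq0.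
have cd0 : c ^+ d != 0 by rewrite expf_neq0.
exists ((4 * k + 1) * d)%N, (F \mPo lq), (G \mPo lq); split.
- exact: hcomp.
- exact: hcomp.
- by move: G0; rewrite evE // mulf_eq0 negb_or => /andP [].
- by rewrite !resE // fmorph_div -mulf_div divff // mul1r.
- by rewrite !evE // -mulf_div divff // mul1r.
Qed.

(** * The degree *)

Lemma horner_form N (p U V : {poly algC}) z :
  (form polyC N p U V).[z] = form idfun N p U.[z] V.[z].
Proof.
rewrite -[LHS]/(horner_eval z _) rmorph_form; apply: eq_form => c /=.
exact: hornerC.
Qed.

Lemma monic_X4B1 : 'X^4 - 1 \is @monic algC.
Proof. exact: monicXnsubC. Qed.

Lemma size_X4B1 : size ('X^4 - 1 : {poly algC}) = 5%N.
Proof. exact: size_XnsubC. Qed.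

Lemma form_term_monic N j : (j <= N)%N ->
  let T : {poly algC} := 'X^4 ^+ j * ('X^4 - 1) ^+ (N - j) in
  T \is monic /\ size T = (4 * N).+1%N.
Proof.
move=> jN T; have X4n : ('X^4 : {poly algC}) ^+ j \is monic by rewrite monic_exp ?monicXn.
split; first by rewrite monicMr // monic_exp ?monic_X4B1.
have szX : size (('X^4 : {poly algC}) ^+ j) = (4 * j).+1%N by rewrite -exprM size_polyXn.
rewrite size_monicM ?monic_neq0 ?monic_exp ?monicX ?monic_X4B1 // szX.
have : (0 < size ((('X^4 - 1) : {poly algC}) ^+ (N - j)))%N.
  by rewrite size_poly_gt0 monic_neq0 ?monic_exp ?monic_X4B1.
have := size_exp ('X^4 - 1 : {poly algC}) (N - j); rewrite size_X4B1.
by move: (size (('X^4 - 1 : {poly algC}) ^+ (N - j))) => s; lia.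
Qed.

Lemma size_form_leq N (p : {poly algC}) :
  (size (form polyC N p 'X^4 ('X^4 - 1)) <= (4 * N).+1)%N.
Proof.
apply: leq_trans (size_sum _ _ _) _; apply/bigmax_leqP => j _.
have [_ szT] := @form_term_monic N j (ltn_ord j : j <= N)%N.
by rewrite mul_polyC (leq_trans (size_scale_leq _ _)) ?szT.
Qed.

(** The terms of the form are multiples of monic polynomials of the same degree [4N], so its
    coefficient of degree [4N] is the sum of the coefficients of [p], that is [p(1)]. *)
Lemma size_form N (p : {poly algC}) : size p = N.+1 -> p.[1] != 0 ->
  size (form polyC N p 'X^4 ('X^4 - 1)) = (4 * N).+1%N.
Proof.
move=> szp p1; apply/eqP; rewrite eqn_leq size_form_leq ltnNge.
apply: contra p1 => /leq_sizeP /(_ _ (leqnn _)) e; apply/eqP.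
rewrite -[RHS]e coef_sum horner_coef szp; apply: eq_bigr => j _.
have [/monicP lT szT] := @form_term_monic N j (ltn_ord j : j <= N)%N.
by rewrite expr1n coefCM; move: lT; rewrite lead_coefE szT => ->.
Qed.

(** At a common root [z] with [z^4 != 1], put [t = z^4 / (z^4 - 1)]: either [z = 0] and [Q(0) = 0],
    or [P] and [Q] vanish together at [t]. If [z^4 = 1], then [t = oo] and the first polynomial
    takes the nonzero value [z] times the leading coefficient of [P]. *)
Lemma coprimep_form k (P Q : {poly algC}) :
  size P = k.+1 -> size Q = k.+1 ->
  Q.[0] != 0 -> (forall z, root P z -> Q.[z] != 0) ->
  coprimep ('X * form polyC k P 'X^4 ('X^4 - 1)) (form polyC k Q 'X^4 ('X^4 - 1)).
Proof.
move=> degP degQ Q0 coPQ; apply: Pdiv.ClosedField.root_coprimep => z.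
have X41 : ('X^4 - 1 : {poly algC}).[z] = z ^+ 4 - 1 by rewrite !hornerE.
rewrite rootM /root hornerX !horner_form X41 hornerXn.
have [b0 rP|b0] := eqVneq (z ^+ 4 - 1) 0.
  have z4 : z ^+ 4 = 1 by apply/eqP; rewrite -subr_eq0 b0.
  move: rP; rewrite b0 form_b0 z4 expr1n mulr1 (negPf (coef_last_neq0 degP)) orbF.
  move=> /eqP z0; move/eqP: z4.
  by rewrite z0 expr0n eq_sym oner_eq0.
rewrite !formE ?degP ?degQ // !map_poly_id //.
rewrite !mulf_eq0 !negb_or expf_eq0 (negPf b0) andbF /=.
by case/orP => [/eqP ->|/coPQ //]; rewrite expr0n mul0r.
Qed.

(** This is [form_curve_eq] at [a = u^4], [b = u^4 - 1], where [a - b = 1]. Divided by the fourth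
    power of the form of [Q], it says [y^2 = x^4 - 1]. *)
Lemma poly_form_eq k (P Q R : {poly algC}) :
  'X * P ^+ 4 = ('X - 1) * Q ^+ 4 + R ^+ 2 ->
  size P = k.+1 -> size Q = k.+1 -> size R = (2 * k).+1%N ->
  form polyC (2 * k) R 'X^4 ('X^4 - 1) ^+ 2 * ('X^4 - 1) =
    ('X * form polyC k P 'X^4 ('X^4 - 1)) ^+ 4 - form polyC k Q 'X^4 ('X^4 - 1) ^+ 4.
Proof.
move=> hPQR degP degQ degR; apply/eqP; rewrite -subr_eq0; apply/eqP/poly_ext0 => z.
have : ('X^4 - 1 : {poly algC}).[z] = z ^+ 4 - 1 by rewrite !hornerE.
move: ('X^4 - 1 : {poly algC}) => W hW.
have := form_curve_eq (z ^+ 4) (z ^+ 4 - 1) hPQR degP degQ degR.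
rewrite !(hornerN, horner_exp, hornerM, hornerD) !horner_form hW hornerX hornerXn.
by rewrite [_ * (_ - 1)]mulrC => ->; ring.
Qed.

Lemma rmorph_form_X4 (K : fieldType) (iota : {rmorphism {poly algC} -> K}) v N p :
  v ^+ 2 = iota ('X^4 - 1) ->
  iota (form polyC N p 'X^4 ('X^4 - 1))
    = form (iota \o polyC) N p ((iota 'X ^+ 2) ^+ 2) (v ^+ 2).
Proof. by move=> ->; rewrite rmorph_form -exprM -rmorphXn. Qed.

Lemma coords_scale n (p : proj n) (x y : 'rV[algC]_n.+1) (c : algC) :
  coords p x -> c != 0 -> x = c *: y -> coords p y.
Proof.
move=> px c0 Ex; rewrite /coords px; apply/eqP.
by rewrite eqEdim -memvE Ex memvZ ?memv_line //= !dim_vline scaler_eq0 (negPf c0).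
Qed.

Lemma Phi_induced k (P Q R : {poly algC}) (phi : E -> E) :
  size P = k.+1 -> size Q = k.+1 -> size R = (2 * k).+1%N ->
  (forall x, coords (val (phi x)) (mev (Phi_mpoly k P Q R) (rep (val x)))) ->
  induced_by P Q R phi.
Proof.
move=> degP degQ degR phiE x u v xuv t v0 Qt0.
have [c c0 Ec] := coordsZ xuv.
have v20 : v ^+ 2 != 0 by rewrite expf_neq0.
have fE N (p : {poly algC}) : size p = N.+1 ->
    form idfun N p ((u ^+ 2) ^+ 2) (v ^+ 2) = (v ^+ 2) ^+ N * p.[t].
  by move=> szp; rewrite formE ?szp // map_poly_id // -exprM.
have q0 : form idfun k Q ((u ^+ 2) ^+ 2) (v ^+ 2) != 0.
  by rewrite fE // mulf_neq0 // expf_neq0.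
(* The power of [c] comes from the chosen representative [c (1, u, u^2, v)] and the degree of the
   forms, the second factor [q^2] from clearing denominators in [Phi_aff]. *)
apply: (coords_scale (c := c ^+ (4 * k + 1)
    * form idfun k Q ((u ^+ 2) ^+ 2) (v ^+ 2) ^+ 2) (phiE x)).
  by rewrite mulf_neq0 // expf_neq0.
apply/rowP => j; rewrite [LHS]mxE.
rewrite (@meval_eq _ _ _ (fun i => c * aff u v i)) => [|i]; last by rewrite Ec !mxE.
rewrite (mevalZ_homog _ _ (dhomog_Phi k P Q R j)) !mxE -mulrA; congr (_ * _).
have -> : P.[t] / Q.[t] = form idfun k P ((u ^+ 2) ^+ 2) (v ^+ 2)
    / form idfun k Q ((u ^+ 2) ^+ 2) (v ^+ 2).
  by rewrite !fE // -mulf_div divff ?mul1r // expf_neq0.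
have -> : R.[t] / Q.[t] ^+ 2 = form idfun (2 * k) R ((u ^+ 2) ^+ 2) (v ^+ 2)
    / form idfun k Q ((u ^+ 2) ^+ 2) (v ^+ 2) ^+ 2.
  rewrite !fE // [(_ * Q.[t]) ^+ 2]exprMn -[_ ^+ k ^+ 2]exprM [(k * 2)%N]mulnC.
  by rewrite -mulf_div divff ?mul1r // !expf_neq0.
rewrite -Phi_aff // /Phi_mpoly rmorph_Phi; apply: eq_Phi => [b|i] /=.
  exact: mevalC.
exact: mevalXU.
Qed.

Lemma quartic_div_eq (K : fieldType) (a b c w : K) :
  b != 0 -> c ^+ 2 * w = a ^+ 4 - b ^+ 4 ->
  (c / b ^+ 2) ^+ 2 * w = (a / b) ^+ 4 - 1.
Proof. by move=> b0 e; rewrite expr_div_n mulrAC e; field. Qed.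

(** The pullback sends [u] to [A / B] and [v] to [r v]. The value [P(1) != 0] gives [A] its full
    degree [4k + 1], and [R(0) != 0] makes [r] nonzero. *)
Lemma Phi_degree k (P Q R : {poly algC}) (phi : E -> E) :
  'X * P ^+ 4 = ('X - 1) * Q ^+ 4 + R ^+ 2 ->
  size P = k.+1 -> size Q = k.+1 -> size R = (2 * k).+1%N ->
  Q.[0] != 0 -> P.[1] != 0 -> R.[0] != 0 -> (forall z, root P z -> Q.[z] != 0) ->
  (forall x, coords (val (phi x)) (mev (Phi_mpoly k P Q R) (rep (val x)))) ->
  has_degree phi (4 * k + 1)%N.
Proof.
move=> hPQR degP degQ degR Q0 P1 R0 coPQ phiE.
pose A := 'X * form polyC k P 'X^4 ('X^4 - 1).
pose B := form polyC k Q 'X^4 ('X^4 - 1).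
pose C := form polyC (2 * k) R 'X^4 ('X^4 - 1).
have coAB : coprimep A B by exact: coprimep_form.
have szF := size_form degP P1.
have szA : size A = (4 * k).+2.
  by rewrite /A mulrC size_mulX ?szF // -size_poly_gt0 szF.
have szB : (size B < size A)%N by rewrite szA ltnS size_form_leq.
have B0 : B != 0.
  by apply: contraTneq coAB => ->; rewrite coprimep0 -size_poly_eq1 szA.
(* At [u = 0] one has [u^4 - 1 = -1] and [t = 0], so [C(0)] is [R(0)] up to sign. *)
have C0 : C != 0.
  apply/eqP => /(congr1 (fun p => p.[0])); apply/eqP.
  rewrite horner0 horner_form !hornerE expr0n /= sub0r formE ?degR //.
    by rewrite map_poly_id // mul0r mulf_neq0 // expf_neq0 // oppr_eq0 oner_eq0.
  by rewrite oppr_eq0 oner_eq0.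
have [sigma sigmaC sigmaX] := rational_substitution coAB szA.
pose r := tofrac C / tofrac B ^+ 2.
have Er : r ^+ 2 * tofrac ('X^4 - 1) = sigma (tofrac ('X^4 - 1)).
  have /(congr1 (@tofrac _)) := poly_form_eq hPQR degP degQ degR.
  rewrite -/A -/B -/C => EC.
  have -> : sigma (tofrac ('X^4 - 1)) = (tofrac A / tofrac B) ^+ 4 - 1.
    by rewrite -sigmaX -rmorphXn -(rmorph1 sigma) -rmorphB tofracB tofracXn.
  apply: quartic_div_eq; first by rewrite tofrac_eq0.
  by rewrite -!tofracXn -tofracM -tofracB.
have [f fC fv] := Efun_lift Er.
exists f; last first.
  (* The basis is [1, u, ..., u^(4k)], from [rational_substitution_basis] with [n = 4k]. *)
  rewrite addn1; apply: (Efun_lift_degree _ fC fv).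
    by rewrite mulf_neq0 ?invr_eq0 ?expf_neq0 ?tofrac_eq0.
  exact: (rational_substitution_basis coAB szA szB sigmaC sigmaX).
have fu : f Efun_u = Efun_u * (Efun_base (form polyC k P 'X^4 ('X^4 - 1)) / Efun_base B).
  rewrite -[Efun_u in LHS]/(Efun_frac (tofrac 'X)) fC sigmaX fmorph_div mulrA.
  by congr (_ / _); exact: (rmorphM Efun_base).
have fv' : f Efun_v = Efun_v * (Efun_base C / Efun_base B ^+ 2).
  by rewrite fv mulrC fmorph_div rmorphXn.
have formE N p : form Efun_const N p ((Efun_u ^+ 2) ^+ 2) (Efun_v ^+ 2)
    = Efun_base (form polyC N p 'X^4 ('X^4 - 1)).
  exact/esym/(rmorph_form_X4 (iota := Efun_base))/Efun_v2.
apply: (@Phi_pullback k P Q R); rewrite ?formE //.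
- by rewrite -[Efun_base _]/(Efun_frac (tofrac B)) fmorph_eq0 tofrac_eq0.
- move=> c /=; rewrite -[Efun_const c]/(Efun_frac (tofrac c%:P)) fC.
  by congr Efun_frac; exact: sigmaC.
Qed.

(** * Choice of the sign and construction of the endomorphism *)

Theorem proposition1p7 (k : nat) (P Q R : {poly algC})
  (hPQR : 'X * P ^+ 4 = ('X - 1) * Q ^+ 4 + R ^+ 2)
  (degP : size P = k.+1) (degQ : size Q = k.+1) (degR : size R = (2 * k).+1%N)
  (hsimple : no_multiple_root ('X * ('X - 1) * P * Q * R)) :
  exists R' : {poly algC}, (R' = R \/ R' = - R) /\
    exists phi : E -> E,
      [/\ is_morphism phi, phi origin = origin, induced_by P Q R' phi
        & has_degree phi (4 * k + 1)%N].
Proof.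
have simple_factors U V z : U * V %| 'X * ('X - 1) * P * Q * R -> root U z -> V.[z] != 0.
  apply: no_multiple_root_factors => //.
  have X1 : 'X - 1 != 0 :> {poly algC} by exact: monic_neq0 (monicXsubC 1).
  by rewrite !mulf_neq0 ?polyX_eq0 // -size_poly_gt0 ?degP ?degQ ?degR.
have Q0 : Q.[0] != 0.
  apply: (simple_factors 'X); last by rewrite /root hornerX.
  by apply/dvdpP; exists (('X - 1) * P * R); ring.
have P1 : P.[1] != 0.
  apply: (simple_factors ('X - 1)); last by rewrite /root !hornerE subrr.
  by apply/dvdpP; exists ('X * Q * R); ring.
have coPQ z : root P z -> Q.[z] != 0.
  by apply: simple_factors; apply/dvdpP; exists ('X * ('X - 1) * R); ring.
have coQP z : root Q z -> P.[z] != 0.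
  by apply: simple_factors; apply/dvdpP; exists ('X * ('X - 1) * R); ring.
have [R' [R'E hPQR' R'0]] : exists R' : {poly algC}, [/\ R' = R \/ R' = - R,
    'X * P ^+ 4 = ('X - 1) * Q ^+ 4 + R' ^+ 2 & R'.[0] = Q.[0] ^+ 2].
  have : R.[0] ^+ 2 == (Q.[0] ^+ 2) ^+ 2.
    have /(congr1 (fun p => p.[0])) := hPQR.
    rewrite !(horner_exp, hornerM, hornerD, hornerN, hornerX) hornerC.
    rewrite mul0r sub0r mulN1r => /eqP; rewrite eq_sym addrC subr_eq0 => /eqP ->.
    by rewrite -exprM.
  rewrite eqf_sqr => /orP [/eqP e|/eqP e]; first by exists R; split; [left| |].
  by exists (- R); split; [right|rewrite sqrrN|rewrite hornerN e opprK].
exists R'; split=> //.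
have {}degR : size R' = (2 * k).+1%N by case: R'E => ->; rewrite ?size_polyN.
have rep_on_E (x : E) : on_E (rep (val x)) := valP x.
have phi_neq0 (x : E) : mev (Phi_mpoly k P Q R') (rep (val x)) != 0.
  exact: Phi_neq0 (repN0 _) (rep_on_E x).
pose phi (x : E) : E := exist _
  (line (phi_neq0 x))
  (on_E_line _ (Phi_on_E hPQR' degP degQ degR (rep_on_E x))).
have phiE x : coords (val (phi x)) (mev (Phi_mpoly k P Q R') (rep (val x))) by [].
have phi_induced : induced_by P Q R' phi by exact: (Phi_induced (k := k)).
exists phi; split=> //.
- move=> x; exists (4 * k + 1)%N, (Phi_mpoly k P Q R'); split=> // j.
  exact: dhomog_Phi.
(* At the origin [t = 0], so [x = 0] and [y = i R'(0) / Q(0)^2 = i] by the choice of sign. *)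
- do 2!apply: val_inj.
  have := phi_induced origin 0 'i erefl.
  rewrite /= expr0n mul0r Q0 R'0 mul0r divff ?expf_neq0 // mulr1.
  by apply=> //; rewrite -sqrf_eq0 sqrCi oppr_eq0 oner_eq0.
have R'0N : R'.[0] != 0 by rewrite R'0 expf_neq0.
exact: (Phi_degree hPQR' degP degQ degR Q0 P1 R'0N coPQ phiE).
Qed.
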